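(* Let $V$ be an integrable $U_{q,\pi}(\mathfrak{sl}_2)$-module. There is a $\mathbb Q(q)^\pi$-linear automorphism $T:V\to V$ sending $1_{-k}V$ onto $1_kV$ for every $k\in\mathbb Z$, given on $v\in 1_{-k}V$ by $$T(v)=\sum_{d\ge\max(0,-k)}(-q)^dE^{(k+d)}F^{(d)}v,$$ whose inverse is given on $v\in 1_kV$ by $$T^{-1}(v)=\sum_{d\ge\max(0,-k)}(-q)^{-d}\,\overline F^{(k+d)}\,\overline E^{(d)}v.$$
   Context: $\mathbb Q(q)^\pi:=\mathbb Q(q)[\pi]/(\pi^2-1)$; $[n]_{q,\pi}:=\frac{(\pi q)^n-q^{-n}}{\pi q-q^{-1}}$, $[d]^!_{q,\pi}:=[d]_{q,\pi}\cdots[1]_{q,\pi}$. The bar involution is the $\mathbb Q^\pi$-algebra involution $c\mapsto\overline c$ of $\mathbb Q(q)^\pi$ with $\overline q=q^{-1}$, $\overline\pi=\pi$. $U_{q,\pi}(\mathfrak{sl}_2)$ is the locally unital $\mathbb Q(q)^\pi$-algebra with mutually orthogonal idempotents $1_k$ ($k\in\mathbb Z$) and generators $E1_k=1_{k+2}E$, $F1_k=1_{k-2}F$ subject to $EF1_k-\pi FE1_k=\overline{[k]_{q,\pi}}\,1_k$ for all $k$. Divided powers: $E^{(d)}1_k:=E^d1_k/[d]^!_{q,\pi}$, $F^{(d)}1_k:=F^d1_k/[d]^!_{q,\pi}$, $\overline E^{(d)}1_k:=E^d1_k/\overline{[d]^!_{q,\pi}}$, $\overline F^{(d)}1_k:=F^d1_k/\overline{[d]^!_{q,\pi}}$.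 A module is a locally unital left module $V=\bigoplus_k1_kV$; it is integrable if every $v\in 1_kV$ is annihilated by $E^n1_k$ and $F^n1_k$ for $n\gg0$. *)

(* Defs.v *)
From HB Require Import structures.
From mathcomp Require Import all_boot all_order all_algebra.
From mathcomp Require Import fraction generic_quotient.
From mathcomp Require Import ring.
Set Implicit Arguments. Unset Strict Implicit. Unset Printing Implicit Defensive.
Import Order.TTheory GRing.Theory Num.Theory.
Local Open Scope ring_scope.

Definition Qq : fieldType := {fraction {poly rat}}.
Definition qq : Qq := tofrac ('X : {poly rat}).
Definition ratQ (c : rat) : Qq := tofrac (c%:P).

Definition barQ (x : Qq) : Qq :=
  let r := repr x in
  (map_poly ratQ (\n_r)).[qq^-1] / (map_poly ratQ (\d_r)).[qq^-1].

(* Q(q)^pi := Q(q)[pi]/(pi^2 - 1); (a, b) represents a + b pi *)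
Definition Qpi : Type := (Qq * Qq)%type.
HB.instance Definition _ := GRing.Zmodule.on Qpi.

Definition Qpi_one : Qpi := (1, 0).
Definition Qpi_mul (x y : Qpi) : Qpi :=
  (x.1 * y.1 + x.2 * y.2, x.1 * y.2 + x.2 * y.1).

Lemma Qpi_mulA : associative Qpi_mul.
Proof. move=> [a b] [c d] [e f]; rewrite /Qpi_mul /=; congr pair; rewrite /=; ring. Qed.
Lemma Qpi_mulC : commutative Qpi_mul.
Proof. by move=> [a b] [c d]; rewrite /Qpi_mul /=; congr pair; ring. Qed.
Lemma Qpi_mul1 : left_id Qpi_one Qpi_mul.
Proof. by move=> [a b]; rewrite /Qpi_mul /=; congr pair; ring. Qed.
Lemma Qpi_mulDl : left_distributive Qpi_mul +%R.
Proof. move=> [a b] [c d] [e f]; rewrite /Qpi_mul /=; congr pair; rewrite /=; ring. Qed.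
Lemma Qpi_one_neq0 : Qpi_one != 0.
Proof. by apply/eqP => -[] /eqP; rewrite oner_eq0. Qed.

HB.instance Definition _ := GRing.Zmodule_isComNzRing.Build Qpi
  Qpi_mulA Qpi_mulC Qpi_mul1 Qpi_mulDl Qpi_one_neq0.

Definition Qpi_norm (x : Qpi) : Qq := x.1 ^+ 2 - x.2 ^+ 2.
Definition Qpi_unit : {pred Qpi} := fun x => Qpi_norm x != 0.
Definition Qpi_inv (x : Qpi) : Qpi :=
  if Qpi_unit x then (x.1 / Qpi_norm x, - x.2 / Qpi_norm x) else x.

Lemma Qpi_mulE (x y : Qpi) : x * y = Qpi_mul x y. Proof. by []. Qed.
Lemma Qpi_oneE : 1 = Qpi_one :> Qpi. Proof. by []. Qed.

Lemma Qpi_inv_aux (K : fieldType) (a b : K) : a ^+ 2 - b ^+ 2 != 0 ->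
  (a / (a ^+ 2 - b ^+ 2) * a + - b / (a ^+ 2 - b ^+ 2) * b = 1) /\
  (a / (a ^+ 2 - b ^+ 2) * b + - b / (a ^+ 2 - b ^+ 2) * a = 0).
Proof. by move=> H; split; field. Qed.

Lemma Qpi_mulVx : {in Qpi_unit, left_inverse 1 Qpi_inv *%R}.
Proof.
move=> [a b] Hu; have {}Hu : Qpi_norm (a, b) != 0 by exact: Hu.
rewrite /Qpi_inv /Qpi_unit /= ifT //.
rewrite Qpi_mulE Qpi_oneE /Qpi_mul /Qpi_one /=.
move: Hu; rewrite /Qpi_norm /= => Hu.
by case: (Qpi_inv_aux Hu) => -> ->.
Qed.

Lemma Qpi_unitPl (x y : Qpi) : y * x = 1 -> Qpi_unit x.
Proof.
case: x y => [a b] [c d]; rewrite Qpi_mulE Qpi_oneE /Qpi_mul /Qpi_one /=.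
case=> H1 H2; rewrite /Qpi_unit /Qpi_norm /=; apply/eqP => H.
have : (c ^+ 2 - d ^+ 2) * (a ^+ 2 - b ^+ 2) = 1.
  have -> : (c ^+ 2 - d ^+ 2) * (a ^+ 2 - b ^+ 2) =
            (c * a + d * b) ^+ 2 - (c * b + d * a) ^+ 2 by ring.
  by rewrite H1 H2 expr1n expr0n subr0.
by rewrite H mulr0 => /eqP; rewrite eq_sym oner_eq0.
Qed.

Lemma Qpi_invr_out : {in [predC Qpi_unit], Qpi_inv =1 id}.
Proof. by move=> x Hx; rewrite /Qpi_inv ifF //; apply: negbTE. Qed.

HB.instance Definition _ := GRing.ComNzRing_hasMulInverse.Build Qpi
  Qpi_mulVx Qpi_unitPl Qpi_invr_out.

Lemma Qpi_invE (x : Qpi) : x^-1 = Qpi_inv x. Proof. by []. Qed.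

Definition q : Qpi := (qq, 0).
Definition pi : Qpi := (0, 1).

Definition bar (x : Qpi) : Qpi := (barQ x.1, barQ x.2).

Definition qint (n : int) : Qpi := ((pi * q) ^ n - q ^ (- n)) / (pi * q - q^-1).

Definition qfact (d : nat) : Qpi := \prod_(1 <= i < d.+1) qint i%:Z.

Section Module.
Variable V : lmodType Qpi.

Definition divpow (X : V -> V) (d : nat) (v : V) : V := (qfact d)^-1 *: iter d X v.
Definition bardivpow (X : V -> V) (d : nat) (v : V) : V :=
  (bar (qfact d))^-1 *: iter d X v.

(* A (locally unital, left) U_{q,pi}(sl_2)-module structure on V, given by the
   actions of the idempotents 1_k (onek k), of E and of F (E acts on V as the
   sum of the E 1_k, which is well defined by local unitality). *)
Definition is_Uqpi_module (onek : int -> {linear V -> V}) (E F : {linear V -> V}) : Prop :=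
  [/\ (forall k l v, onek k (onek l v) = if k == l then onek k v else 0),
      (forall v, exists s : seq int, v = \sum_(k <- s) onek k v),
      (forall k v, E (onek k v) = onek (k + 2) (E v)),
      (forall k v, F (onek k v) = onek (k - 2) (F v)) &
      (forall k v, E (F (onek k v)) - pi *: F (E (onek k v)) = bar (qint k) *: onek k v)].

Definition in_weight (onek : int -> {linear V -> V}) (k : int) (v : V) : Prop := onek k v = v.

Definition integrable (onek : int -> {linear V -> V}) (E F : {linear V -> V}) : Prop :=
  forall k v, in_weight onek k v ->
    exists N : nat, forall n : nat, (N <= n)%N -> iter n E v = 0 /\ iter n F v = 0.

Definition finsum_from (m : nat) (f : nat -> V) (s : V) : Prop :=
  exists N : nat, (forall d, (N <= d)%N -> f d = 0) /\ s = \sum_(m <= d < N) f d.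

End Module.

Definition lowbd (k : int) : nat := absz (Num.max 0 (- k)).

(* Main.v *)
Require Import Defs.
From HB Require Import structures.
From mathcomp Require Import all_boot all_order all_algebra.
From mathcomp Require Import ring zify.
From mathcomp Require boolp.
Import Order.TTheory GRing.Theory Num.Theory.
(* [all_boot] shadows [Defs.pi]. *)
Import Defs.
Local Open Scope ring_scope.

Set Implicit Arguments.
Unset Strict Implicit.
Unset Printing Implicit Defensive.

(** Write [T] for the reflection. The commutation formulas for [E F^(d)] and
    [F E^(a)] give the intertwining relation [T E = - q^k F T] on the weight
    space [- k]. Exchanging [E] with [F], [1_k] with [1_{-k}] and [q] with
    [q^-1] preserves the defining relations and turns [T] into the proposed
    inverse [T'], which hence satisfies [T' F = - q^{-k} E T']. So [T' T]
    commutes with [E]. On a lowest weight vector [u] of weight [- n] both sums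
    have a single term, [T u = E^(n) u] and [T' T u] is [F^n E^n u] divided by
    [n]! times its bar conjugate, that is [u]. Finally, an integrable module is
    spanned by the vectors [E^j u] with [u] of lowest weight; [T T' = 1] follows
    from the same symmetry. *)

Lemma exprMzr (R : comUnitRingType) (x y : R) (n : int) :
  x \is a GRing.unit -> y \is a GRing.unit -> (x * y) ^ n = x ^ n * y ^ n.
Proof. by move=> ux uy; rewrite exprMz_comm //; apply: mulrC. Qed.

(** * Quantum integers *)

Section Brackets.
Variables (R : comUnitRingType) (p : R).
Hypothesis pp : p * p = 1.

(* [br q n] is the quantum integer [n]_{q,pi} and [br q^-1 n] its bar conjugate. *)
Definition br (t : R) (n : int) : R :=
  ((p * t) ^ n - t ^ (- n)) / (p * t - t^-1).

Definition brfact (t : R) (a : nat) : R := \prod_(1 <= i < a.+1) br t i%:Z.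

(** [Q(q)^pi] has zero divisors, so whatever is divided by is required to be a unit, not just
    nonzero. The parameter [t] stands for [q] or [q^-1]. *)
Record admissible (t : R) : Prop := Admissible {
  adm_unit : t \is a GRing.unit;
  adm_diff : p * t - t^-1 \is a GRing.unit;
  adm_br : forall n : nat, (0 < n)%N -> br t n%:Z \is a GRing.unit }.

Lemma p_unit : p \is a GRing.unit.
Proof. by apply/unitrPr; exists p. Qed.

Lemma exprz_pV (n : int) : p ^ (- n) = p ^ n.
Proof.
by rewrite -exprz_inv; congr (_ ^ n); apply: (mulrI p_unit); rewrite divrr ?p_unit.
Qed.

Lemma exprz_pp (n : int) : p ^ n * p ^ n = 1.
Proof. by rewrite -exprMzr ?p_unit // pp exp1rz. Qed.

Section Fixed.
Variable t : R.
Hypothesis ht : admissible t.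
Let ut := adm_unit ht.
Let uD := adm_diff ht.
Let upt : p * t \is a GRing.unit. Proof. by rewrite unitrM p_unit. Qed.
Let utV : t^-1 \is a GRing.unit. Proof. by rewrite unitrV. Qed.

(** Bracket identities are checked after multiplication by the unit [p * t - t^-1], where they
    become identities between powers. *)
Lemma br_diff n : br t n * (p * t - t^-1) = (p * t) ^ n - t^-1 ^ n.
Proof. by rewrite /br divrK // exprz_inv. Qed.

Lemma br0 : br t 0 = 0.
Proof. by rewrite /br oppr0 !expr0z subrr mul0r. Qed.

Lemma br1 : br t 1 = 1.
Proof. by apply: (mulIr uD); rewrite br_diff !expr1z mul1r. Qed.

Lemma pt_tV : p * t * t^-1 = p.
Proof. by rewrite mulrK. Qed.

Lemma brS n : br t (n + 1) - t^-1 * br t n = (p * t) ^ n.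
Proof.
apply: (mulIr uD); rewrite /= mulrBl -(mulrA _ (br t _)) !br_diff !exprzDr // !expr1z; ring.
Qed.

Lemma br_subS n : br t n - t * br t (n + 1) = - p * (p * t) ^ (n + 1).
Proof.
apply: (mulIr uD); rewrite /= mulrBl -(mulrA _ (br t _)) !br_diff !exprzDr // !expr1z.
have e : t * t^-1 = 1 by rewrite divrr.
set A := _ ^ n; set B := _ ^ n.
transitivity (A * (1 - p * t * t) + B * (t * t^-1 - 1)); first by ring.
transitivity (A * ((p * p) * (t * t^-1) - (p * p) * p * t * t)); last by ring.
by rewrite pp e; ring.
Qed.

Lemma br_rec (m : int) (d : nat) :
  br t (d%:Z + 1) * br t (m - d%:Z) =
  br t d * br t (m - d%:Z + 1) + p ^+ d * br t (m - d%:Z - d%:Z).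
Proof.
apply: (mulIr uD); apply: (mulIr uD) => /=.
set n := m - d%:Z - d%:Z.
have -> : m - d%:Z = n + d by rewrite /n; ring.
pose D := p * t - t^-1.
transitivity ((br t (d%:Z + 1) * D) * (br t (n + d) * D)); first by rewrite /D; ring.
transitivity ((br t d * D) * (br t (n + d + 1) * D) + p ^+ d * (br t n * D) * D);
  last by rewrite /D; ring.
rewrite /D !br_diff !exprzDr // !expr1z.
have -> : p ^+ d = (p * t) ^ d%:Z * t^-1 ^ d%:Z by rewrite -exprMzr // pt_tV.
ring.
Qed.

Lemma pt_inv : p * t^-1 = (p * t)^-1.
Proof.
by apply: (mulrI upt); rewrite divrr // mulrACA pp divrr // mulr1.
Qed.

(** Inverting [t] multiplies the numerator by [- p ^ n] and the denominator by [- p]. *)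
Lemma br_inv n : br t^-1 n = p ^ (n + 1) * br t n.
Proof.
have uD' : p * t^-1 - t^-1^-1 \is a GRing.unit.
  have -> : p * t^-1 - t^-1^-1 = - (p * (p * t - t^-1)).
    by rewrite invrK mulrBr mulrA pp mul1r opprB.
  by rewrite unitrN unitrM p_unit.
apply: (mulIr uD').
rewrite {1}/br divrK // invrK.
have -> : p ^ (n + 1) * br t n * (p * t^-1 - t) =
   - (p ^ (n + 1) * p * (br t n * (p * t - t^-1))).
  have e : t = p * p * t by rewrite pp mul1r.
  have -> : p * t^-1 - t = - (p * (p * t - t^-1)) by rewrite {2}e; ring.
  ring.
rewrite br_diff exprzDr ?p_unit // expr1z -(mulrA _ p p) pp mulr1.
rewrite mulrBr -!exprMzr ?p_unit //.
rewrite opprB mulrA pp mul1r.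
by rewrite -(exprz_inv t^-1) invrK.
Qed.

(** The numerator is unchanged and the denominator picks up [- p]. This is the scalar identity
    behind [Uqpi_swap]. *)
Lemma br_neg n : br t^-1 (- n) = - p * br t n.
Proof.
rewrite /br opprK invrK pt_inv -exprz_inv invrK.
have -> : (p * t)^-1 - t = - p * (p * t - t^-1).
  by rewrite mulrBr -pt_inv mulNr mulrA pp mul1r mulNr opprK addrC.
rewrite invrM // ?unitrN ?p_unit //.
have -> : (- p)^-1 = - p.
  by apply: (mulrI (x := - p)); rewrite ?unitrN ?p_unit // divrr ?unitrN ?p_unit // mulrNN pp.
by rewrite -exprz_inv; ring.
Qed.

(** Recursion for the coefficients in [E_iterF]; it follows from [br_rec] because inverting [t]
    changes a bracket only by a power of [p]. *)
Lemma br_rec_inv (m : int) (d : nat) :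
  br t (d%:Z + 1) * br t^-1 (m - d%:Z) =
  p * (br t d * br t^-1 (m - d%:Z + 1)) + br t^-1 (m - d%:Z - d%:Z).
Proof.
rewrite !br_inv mulrCA br_rec !exprzDr ?p_unit // !exprz_pV expr1z.
have e := exprz_pp d; rewrite -exprnP in e *.
set A := p ^ m; set X := p ^+ d in e *; set a := br t _; set b := br t _; set c := br t _.
transitivity (A * X * p * (a * b) + A * p * c * (X * X)); first by ring.
transitivity (A * X * p * (a * b) * (p * p) + A * (X * X) * p * c); last by ring.
by rewrite pp e; ring.
Qed.

Lemma admissibleV : admissible t^-1.
Proof.
split=> //.
  have -> : p * t^-1 - t^-1^-1 = - (p * (p * t - t^-1)).
    by rewrite invrK mulrBr mulrA pp mul1r opprB.
  by rewrite unitrN unitrM p_unit.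
move=> n n0; rewrite br_inv unitrM (adm_br ht n0) andbT.
by rewrite unitrXz ?p_unit.
Qed.

Lemma brfact_unit a : brfact t a \is a GRing.unit.
Proof.
rewrite /brfact big_nat; apply: rpred_prod => i /andP[i1 _]; exact: (adm_br ht).
Qed.

Lemma brfactS a : brfact t a.+1 = brfact t a * br t a.+1.
Proof. by rewrite /brfact big_nat_recr. Qed.

End Fixed.

(** * Divided powers *)

Section DividedPowers.
Variables (t : R) (V : lmodType R) (X : {linear V -> V}).
Hypothesis ht : admissible t.

Lemma iter0 n : iter n X 0 = 0.
Proof. by elim: n => //= n ->; rewrite linear0. Qed.

Lemma iterD n u v : iter n X (u + v) = iter n X u + iter n X v.
Proof. by elim: n => //= n ->; rewrite linearD. Qed.

Lemma iterZ n a v : iter n X (a *: v) = a *: iter n X v.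
Proof. by elim: n => //= n ->; rewrite linearZ. Qed.

Lemma iter_eq0_le m n v : (m <= n)%N -> iter m X v = 0 -> iter n X v = 0.
Proof. by move=> /subnK <- e; rewrite ssrnat.iterD e iter0. Qed.

(* Zero for negative [z], so that the sums below may run over all [d >= 0]. *)
Definition dpow (z : int) (v : V) : V :=
  if z is Posz a then (brfact t a)^-1 *: iter a X v else 0.

Lemma dpowD z u v : dpow z (u + v) = dpow z u + dpow z v.
Proof. by case: z => z /=; rewrite ?iterD ?scalerDr ?addr0. Qed.

Lemma dpowZ z a v : dpow z (a *: v) = a *: dpow z v.
Proof. by case: z => z /=; rewrite ?iterZ ?scaler0 // !scalerA mulrC. Qed.

Lemma dpow0 z : dpow z 0 = 0.
Proof. by case: z => z //=; rewrite iter0 scaler0. Qed.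

Lemma dpow_comm z v : X (dpow z v) = dpow z (X v).
Proof. by case: z => z /=; rewrite ?linear0 // linearZ -iterSr. Qed.

(** At [z = -1] the right side vanishes because [br t 0 = 0], so the rule holds for every integer
    [z]. *)
Lemma dpowS z v : X (dpow z v) = br t (z + 1) *: dpow (z + 1) v.
Proof.
case: z => [a|[|a]].
- have -> : a%:Z + 1 = a.+1 by lia.
  rewrite /= linearZ /= brfactS invrM ?brfact_unit ?(adm_br ht) //.
  by rewrite scalerA mulrA divrr ?mul1r ?(adm_br ht).
- by rewrite /= linear0 br0 scale0r.
have -> : Negz a.+1 + 1 = Negz a by lia.
by rewrite /= linear0 scaler0.
Qed.

Lemma dpow_killed N (z : int) v : iter N X v = 0 -> N%:Z <= z -> dpow z v = 0.
Proof.
move=> e; case: z => [a|a] /= le; last by lia.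
by rewrite (iter_eq0_le _ e) ?scaler0.
Qed.

End DividedPowers.

(** * Modules and commutation formulas *)

Section Modules.
Variable V : lmodType R.
Implicit Types (wt : int -> {linear V -> V}) (E F : {linear V -> V}).

(* [Uqpi] is kept symmetric: it is stable under exchanging [E] with [F],
   [wt k] with [wt (- k)] and [t] with [t^-1]; see [Uqpi_swap]. *)
Record Uqpi (t : R) wt E F : Prop := {
  Uqpi_orth : forall k l v, wt k (wt l v) = if k == l then wt k v else 0;
  Uqpi_local : forall v, exists s : seq int, v = \sum_(k <- s) wt k v;
  Uqpi_E : forall k v, E (wt k v) = wt (k + 2) (E v);
  Uqpi_F : forall k v, F (wt k v) = wt (k - 2) (F v);
  Uqpi_comm : forall k v,
    E (F (wt k v)) - p *: F (E (wt k v)) = br t^-1 k *: wt k v;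
  Uqpi_nil : forall k v, wt k v = v -> exists N, iter N E v = 0 /\ iter N F v = 0 }.

(** Multiplying the commutation relation at [- k] by [- p] exchanges [E] and [F], and [br_neg] turns
    the scalar into [br t k]. *)
Lemma Uqpi_swap t wt E F : admissible t ->
  Uqpi t wt E F -> Uqpi t^-1 (fun k => wt (- k)) F E.
Proof.
move=> ht [orth loc hE hF comm nil]; split.
- by move=> k l v; rewrite orth eqr_opp.
- move=> v; have [s e] := loc v; exists [seq - k | k <- s].
  by rewrite big_map {1}e; apply: eq_bigr => k _; rewrite opprK.
- by move=> k v; rewrite hF; congr (wt _ _); ring.
- by move=> k v; rewrite hE; congr (wt _ _); ring.
- move=> k v; rewrite invrK; have := comm (- k) v.
  rewrite br_neg // => /(congr1 (fun x => - p *: x)).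
  rewrite scalerBr !scalerA !(mulNr, mulrN) opprK mulrA pp mul1r.
  by rewrite scaleN1r opprK => <-; rewrite addrC scaleNr.
- by move=> k v /nil[N [? ?]]; exists N.
Qed.

Section Fixed.
Variables (t : R) (wt : int -> {linear V -> V}) (E F : {linear V -> V}).
Hypotheses (ht : admissible t) (hU : Uqpi t wt E F).

Lemma wtE k v : wt k v = v -> wt (k + 2) (E v) = E v.
Proof. by move=> e; rewrite -(Uqpi_E hU) e. Qed.

Lemma wtF k v : wt k v = v -> wt (k - 2) (F v) = F v.
Proof. by move=> e; rewrite -(Uqpi_F hU) e. Qed.

Lemma wt_iterE n k v : wt k v = v -> wt (k + n%:Z + n%:Z) (iter n E v) = iter n E v.
Proof.
move=> e; elim: n => [|n IH] /=; first by rewrite !addr0.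
by rewrite -{2}(wtE IH); congr (wt _ _); rewrite intS; ring.
Qed.

Lemma wt_iterF n k v : wt k v = v -> wt (k - n%:Z - n%:Z) (iter n F v) = iter n F v.
Proof.
move=> e; elim: n => [|n IH] /=; first by rewrite !subr0.
by rewrite -{2}(wtF IH); congr (wt _ _); rewrite intS; ring.
Qed.

Lemma EF_comm k v : wt k v = v -> E (F v) = p *: F (E v) + br t^-1 k *: v.
Proof. by move=> e; have := Uqpi_comm hU k v; rewrite e => <-; rewrite addrC subrK. Qed.

(** Each passage of [E] across an [F] costs a factor [p] and a scalar read off the current weight;
    [br_rec_inv] adds up these scalars. *)
Lemma E_iterF m d v : wt m v = v ->
  E (iter d.+1 F v) = p ^+ d.+1 *: iter d.+1 F (E v)
    + (br t (d%:Z + 1) * br t^-1 (m - d%:Z)) *: iter d F v.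
Proof.
move=> e; elim: d => [|d IH].
  by rewrite /= (EF_comm e) expr1 add0r br1 // mul1r subr0.
rewrite iterS (EF_comm (wt_iterF d.+1 e)) IH linearD !linearZ /=.
rewrite scalerDr !scalerA -exprS -addrA -scalerDl; congr (_ + _ *: _).
rewrite (br_rec_inv ht m d.+1).
by congr (p * (br t _ * br t^-1 _) + _); rewrite intS; ring.
Qed.

(** Solved for [F^(d) E], the order met in [T (E v)]; the power of [p] is its own inverse. *)
Lemma dpowF_E m (d : int) v : wt m v = v ->
  dpow t F d (E v) = p ^ d *: E (dpow t F d v)
   - (p ^ d * br t^-1 (m - d + 1)) *: dpow t F (d - 1) v.
Proof.
move=> e; case: d => [[|d]|d].
- by rewrite /= expr0z !scale1r linearZ scaler0 subr0.
- have -> : (d.+1%:Z - 1) = d by lia.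
  have -> : m - d.+1%:Z + 1 = m - d%:Z by lia.
  rewrite /= linearZ /= (E_iterF d e) scalerDr !scalerA scalerDr !scalerA.
  rewrite brfactS // invrM ?brfact_unit ?(adm_br ht) // -exprnP.
  have h : p ^+ d.+1 * p ^+ d.+1 = 1 by rewrite -exprMn pp expr1n.
  have b : br t (d%:Z + 1) = br t d.+1 by congr (br t _); lia.
  rewrite b.
  set f := (brfact t d)^-1; set x := br t d.+1; set y := br t^-1 _; set P := p ^+ _ in h *.
  have ux : x^-1 * x = 1 by rewrite mulVr // (adm_br ht).
  have -> : P * (x^-1 * f * P) = (P * P) * (x^-1 * f) by ring.
  have -> : P * (x^-1 * f * (x * y)) = (x^-1 * x) * (P * y * f) by ring.
  by rewrite h ux !mul1r addrK.
- have -> : Negz d - 1 = Negz d.+1 by lia.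
  by rewrite /= linear0 !scaler0 subr0.
Qed.

End Fixed.

Lemma F_iterE t wt E F m a v : admissible t -> Uqpi t wt E F -> wt m v = v ->
  F (iter a.+1 E v) = p ^+ a.+1 *: iter a.+1 E (F v)
    + (br t^-1 (a%:Z + 1) * br t (- m - a%:Z)) *: iter a E v.
Proof.
move=> ht hU e; have := E_iterF (admissibleV ht) (Uqpi_swap ht hU) (m := - m) (v := v) a.
by rewrite opprK invrK; apply.
Qed.

(** The factor [p ^ (a + 1)] comes from [br_inv], used to cancel the conjugate bracket of [F_iterE]
    against the divided power. *)
Lemma F_dpowE t wt E F m (a : int) v : admissible t -> Uqpi t wt E F -> wt m v = v ->
  F (dpow t E a v) = p ^ a *: dpow t E a (F v)
    + (p ^ (a + 1) * br t (1 - m - a)) *: dpow t E (a - 1) v.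
Proof.
move=> ht hU e; case: a => [[|a]|a].
- by rewrite /= expr0z !scale1r linearZ scaler0 addr0.
- have -> : (a.+1%:Z - 1) = a by lia.
  have -> : 1 - m - a.+1%:Z = - m - a%:Z by lia.
  rewrite /= linearZ /= (F_iterE a ht hU e) scalerDr !scalerA br_inv //.
  rewrite brfactS // invrM ?brfact_unit ?(adm_br ht) // -exprnP.
  have -> : a%:Z + 1 = a.+1 by lia.
  set f := (brfact t a)^-1; set x := br t a.+1; set y := br t _; set P := p ^+ _.
  have ux : x^-1 * x = 1 by rewrite mulVr // (adm_br ht).
  congr (_ *: _ + _ *: _); first by ring.
  set Q := p ^ _.
  have -> : x^-1 * f * (Q * x * y) = (x^-1 * x) * (Q * y * f) by ring.
  by rewrite ux mul1r.
- have -> : Negz a - 1 = Negz a.+1 by lia.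
  by rewrite /= linear0 !scaler0 addr0.
Qed.

End Modules.
End Brackets.

Arguments dpow : simpl never.

(** * The reflection on a weight space *)

Section Reflection.
Variables (R : comUnitRingType) (p : R).
Hypothesis pp : p * p = 1.
Variable V : lmodType R.
Implicit Types (t : R) (E F : {linear V -> V}) (k : int) (u v s : V).

Definition reflsum (t : R) (E F : {linear V -> V}) (k : int) (N : nat) (v : V) : V :=
  \sum_(0 <= d < N) (- t) ^+ d *: dpow p t E (k + d%:Z) (dpow p t F d v).

(** A relation rather than a function, since the cutoff [N] depends on [v]; every [N] with
    [F^N v = 0] gives the same sum. *)
Definition refl_val t E F k v s := exists2 N, iter N F v = 0 & s = reflsum t E F k N v.

Lemma dpow_add_term t (E F : {linear V -> V}) k d a u v :
  (- t) ^+ d *: dpow p t E k (dpow p t F d (a *: u + v)) =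
  a *: ((- t) ^+ d *: dpow p t E k (dpow p t F d u)) +
  (- t) ^+ d *: dpow p t E k (dpow p t F d v).
Proof. by rewrite dpowD dpowZ dpowD dpowZ scalerDr !scalerA mulrC. Qed.

Lemma reflsumP t E F k N a u v :
  reflsum t E F k N (a *: u + v) = a *: reflsum t E F k N u + reflsum t E F k N v.
Proof.
rewrite /reflsum scaler_sumr -big_split /=; apply: eq_bigr => d _.
exact: dpow_add_term.
Qed.

Lemma reflsum_stable t E F k N M v :
  iter N F v = 0 -> (N <= M)%N -> reflsum t E F k M v = reflsum t E F k N v.
Proof.
move=> e le; rewrite /reflsum (big_cat_nat (n := N)) //=.
rewrite [X in _ + X]big_nat [X in _ + X]big1 ?addr0 //.
by move=> d /andP[Nd _]; rewrite (dpow_killed _ _ e) ?dpow0 ?scaler0 // lez_nat.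
Qed.

Lemma refl_val_stable t E F k v s : refl_val t E F k v s ->
  exists N, forall M, (N <= M)%N -> iter M F v = 0 /\ s = reflsum t E F k M v.
Proof.
move=> [N e ->]; exists N => M le; split; first exact: iter_eq0_le le e.
by rewrite (reflsum_stable _ _ _ e).
Qed.

Lemma refl_val_uniq t E F k v s s' :
  refl_val t E F k v s -> refl_val t E F k v s' -> s = s'.
Proof.
move=> /refl_val_stable[N h] /refl_val_stable[N' h'].
have [_ ->] := h (maxn N N') (leq_maxl _ _).
by have [_ ->] := h' (maxn N N') (leq_maxr _ _).
Qed.

Lemma refl_val_linear t E F k a u v s s' :
  refl_val t E F k u s -> refl_val t E F k v s' ->
  refl_val t E F k (a *: u + v) (a *: s + s').
Proof.
move=> /refl_val_stable[N h] /refl_val_stable[N' h'].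
have [e ->] := h (maxn N N') (leq_maxl _ _).
have [e' ->] := h' (maxn N N') (leq_maxr _ _).
exists (maxn N N'); last by rewrite reflsumP.
by rewrite iterD iterZ e e' scaler0 addr0.
Qed.

Lemma refl_val0 t E F k : refl_val t E F k 0 0.
Proof. by exists 0%N => //; rewrite /reflsum big_geq. Qed.

Section Fixed.
Variables (t : R) (wt : int -> {linear V -> V}) (E F : {linear V -> V}).
Hypotheses (ht : admissible p t) (hU : Uqpi p t wt E F).
Let up := p_unit pp.
Let ut := adm_unit ht.

(** Both sides are expanded in the vectors [E^(k+d-1) F^(d) v], and the coefficients agree for each
    [d]. *)
Lemma reflsum_E k N v : wt (- k) v = v -> iter N F v = 0 -> iter N F (E v) = 0 ->
  reflsum t E F (k - 2) N.+1 (E v) = - t ^ k *: F (reflsum t E F k N.+1 v).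
Proof.
move=> e eF eFE; pose X (d : int) := dpow p t E (k + d - 1) (dpow p t F d v).
have X0 (d : nat) : (N <= d)%N -> X d = 0.
  by move=> le; rewrite /X (dpow_killed _ _ eF) ?dpow0 // lez_nat.
(* [A] and [B] come from the two terms of [dpowF_E], [C] and [D] from those of [F_dpowE]; the index
   is shifted down by one in [B] and up by one in [C]. *)
pose A (d : nat) := (- t) ^+ d * p ^+ d * br p t (k + d%:Z - 1).
pose B (d : nat) := - t * ((- t) ^+ d * p ^+ d * br p t (k + d%:Z)).
pose C (d : nat) := - t^-1 * ((- t) ^+ d * p ^ (k + d%:Z + 1) * br p t d).
pose D (d : nat) := (- t) ^+ d * p ^ (k + d%:Z + 1) * br p t (d%:Z + 1).
have p2 : p ^ 2 = 1 by rewrite -exprnP expr2.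
transitivity (\sum_(0 <= d < N.+1) (A d + B d) *: X d).
  under [RHS]eq_bigr do rewrite scalerDl.
  (* The cutoff [N.+1] leaves room for the shift: the last [B] term vanishes with [X N]. *)
  rewrite big_split /= [\sum_(_ <= _ < _) B _ *: _]big_nat_recr //= (X0 N) // scaler0 addr0.
  have -> : \sum_(0 <= d < N) B d *: X d = \sum_(0 <= d < N.+1)
      (if d is d'.+1 then B d' *: X d' else 0).
    by rewrite big_nat_recl // add0r.
  rewrite -big_split /=; apply: eq_bigr => d _.
  rewrite (dpowF_E pp ht hU d e) -scaleNr dpowD !dpowZ -dpow_comm dpowS //.
  have -> : k - 2 + d%:Z + 1 = k + d%:Z - 1 by ring.
  rewrite scalerDr !scalerA -exprnP; congr (_ *: _ + _).
  case: d => [|d]; first by rewrite /= dpow0 scaler0.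
  have -> : d.+1%:Z - 1 = d by lia.
  have -> : k - 2 + d.+1%:Z = k + d%:Z - 1 by lia.
  have -> : - k - d.+1%:Z + 1 = - (k + d%:Z) by lia.
  rewrite br_neg // /B !exprS; congr (_ *: _).
  transitivity (p * p * (- t * ((- t) ^+ d * p ^+ d * br p t (k + d%:Z)))); first by ring.
  by rewrite pp mul1r.
rewrite /reflsum linear_sum scaler_sumr /=.
transitivity (\sum_(0 <= d < N.+1) (- t ^ k * (C d + D d)) *: X d).
  apply: eq_bigr => d _; congr (_ *: _).
  have upt : p * t \is a GRing.unit by rewrite unitrM up.
  (* [br_subS] collapses [A d + B d], and [brS] collapses [C d + D d], to a single product of
     powers. *)
  have := brS pp ht d%:Z; have := br_subS pp ht (k + d%:Z - 1).
  rewrite subrK => hA hD.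
  transitivity ((- t) ^+ d * p ^+ d * (- p * (p * t) ^ (k + d%:Z))).
    by rewrite -hA /A /B; ring.
  transitivity (- t ^ k * ((- t) ^+ d * p ^ (k + d%:Z + 1) * (p * t) ^ d%:Z)); last first.
    by rewrite -hD /C /D; ring.
  rewrite !exprMzr // !exprzDr // expr1z -!exprnP; ring.
under [LHS]eq_bigr do rewrite mulrDr scalerDl.
rewrite big_split /= big_nat_recl //.
have -> : C 0%N = 0 by rewrite /C br0 !mulr0.
rewrite mulr0 scale0r add0r.
have -> : \sum_(0 <= d < N) (- t ^ k * C d.+1) *: X d.+1 =
          \sum_(0 <= d < N.+1) (- t ^ k * C d.+1) *: X d.+1.
  by rewrite [RHS]big_nat_recr //= X0 ?scaler0 ?addr0.
rewrite -big_split /=; apply: eq_bigr => d _.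
have ew : wt (- k - d%:Z - d%:Z) (dpow p t F d v) = dpow p t F d v.
  by rewrite /= linearZ /= (wt_iterF hU).
rewrite linearZ /= -/(dpow p t F d v) (F_dpowE pp _ ht hU ew) dpowS // dpowZ.
rewrite !scalerDr !scalerA.
congr (_ *: _ + _ *: _).
- have et : t^-1 * t = 1 by rewrite mulVr.
  rewrite /C exprS; have -> : d.+1%:Z = d%:Z + 1 by lia.
  rewrite !exprzDr // expr1z -!exprnP.
  set b := br p t _; set y := t ^ k; set z := p ^ k; set x := _ ^+ d; set u := p ^+ d.
  transitivity (- y * x * (z * u) * b * (t^-1 * t) * (p * p)); first by ring.
  by rewrite et pp !mulr1.
- rewrite /X; have -> : d.+1%:Z = d%:Z + 1 by lia.
  by congr (dpow _ _ _ _ _); lia.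
- rewrite /D; have -> : 1 - (- k - d%:Z - d%:Z) - (k + d%:Z) = d%:Z + 1 by ring.
  by ring.
Qed.
End Fixed.
End Reflection.

(** * Generation by lowest weight vectors *)

Section Strings.
Variables (R : comUnitRingType) (p : R).
Hypothesis pp : p * p = 1.
Variable V : lmodType R.

Lemma br_unit t (z : int) : admissible p t -> z != 0 -> br p t z \is a GRing.unit.
Proof.
move=> ht; case: z => z z0; first by rewrite (adm_br ht) // lt0n.
rewrite NegzE -[t]invrK (br_neg pp (admissibleV pp ht)).
by rewrite unitrM unitrN (p_unit pp) (adm_br (admissibleV pp ht)).
Qed.

Section LowestWeight.
Variables (t : R) (wt : int -> {linear V -> V}) (E F : {linear V -> V}).
Hypotheses (ht : admissible p t) (hU : Uqpi p t wt E F).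

(** The scalar by which [F^b] sends [E^(b+c) u] to [E^c u], for [u] of lowest weight [- n]; no
    factor is a bracket of 0 when [b + c <= n]. *)
Definition lowest_coef (n b c : nat) : R :=
  \prod_(0 <= i < b) (br p t^-1 ((i + c)%N%:Z + 1) * br p t (n%:Z - (i + c)%N%:Z)).

Lemma lowest_coef_unit n b c : (b + c <= n)%N -> lowest_coef n b c \is a GRing.unit.
Proof.
move=> le; rewrite /lowest_coef big_nat; apply: rpred_prod => i /andP[_ ib].
rewrite unitrM !br_unit //; first by lia.
  by apply: admissibleV.
by lia.
Qed.

Variables (n : nat) (u : V).
Hypotheses (wu : wt (- n%:Z) u = u) (Fu : F u = 0).

Lemma F_iterE_lowest a :
  F (iter a.+1 E u) = (br p t^-1 (a%:Z + 1) * br p t (n%:Z - a%:Z)) *: iter a E u.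
Proof. by rewrite (F_iterE pp a ht hU wu) Fu iter0 scaler0 add0r opprK. Qed.

Lemma iterF_iterE_lowest b c :
  iter b F (iter (b + c) E u) = lowest_coef n b c *: iter c E u.
Proof.
rewrite /lowest_coef; elim: b => [|b IH]; first by rewrite big_geq // scale1r.
by rewrite iterSr addSn F_iterE_lowest iterZ IH scalerA big_nat_recr //= mulrC.
Qed.

(** For [N > n], [F E^(N+1) u] is a unit multiple of [E^N u], so the vanishing exponent given by
    integrability descends to [n + 1]. *)
Lemma lowest_nil : iter n.+1 E u = 0.
Proof.
have [N [+ _]] := Uqpi_nil hU wu.
elim: N => [|N IH] eN; first exact: iter_eq0_le eN.
have [le|lt] := leqP N n; first exact: iter_eq0_le eN.
apply: IH; have := F_iterE_lowest N; rewrite eN linear0 => /esym e.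
set c := (X in X *: _) in e.
have uc : c \is a GRing.unit.
  by rewrite unitrM !br_unit //; [lia | apply: admissibleV | lia].
by rewrite -[iter N E u]scale1r -(mulVr uc) -scalerA e scaler0.
Qed.

End LowestWeight.

(** Local unitality reduces to weight vectors. The induction is on the exponent of [F] killing [v]
    for weights at most 0, and on that of [E] for weights at least 0; these signs keep [lowest_coef]
    invertible. *)
Lemma string_ind t wt E F (P : V -> Prop) : admissible p t -> Uqpi p t wt E F ->
  P 0 -> (forall a u v, P u -> P v -> P (a *: u + v)) ->
  (forall k v, wt k v = v -> P v -> P (E v)) ->
  (forall (n : nat) u, wt (- n%:Z) u = u -> F u = 0 -> P u) ->
  forall v, P v.
Proof.
move=> ht hU P0 Plin PE Plow.
have PEn n k v : wt k v = v -> P v -> P (iter n E v).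
  move=> wv Pv; elim: n => //= n IH.
  exact: PE (wt_iterE hU n wv) IH.
have PZ a v : P v -> P (a *: v).
  by move=> Pv; rewrite -[a *: v]addr0; apply: Plin.
have Psplit (c : R) y x : P y -> P (x - c *: y) -> P x.
  by move=> Py Pxy; rewrite -[x](subrKC (c *: y)); apply: Plin.
(* With [u := F^N v], of lowest weight [- (M + 2 N)], the vector
   [v - c^-1 E^N u] is killed by [F^N]. *)
have Pneg (M : nat) N v : wt (- M%:Z) v = v -> iter N F v = 0 -> P v.
  elim: N v => [|N IH] v wv eN; first by rewrite [v]eN.
  pose u := iter N F v; pose c := lowest_coef t (M + N + N) N 0.
  have wu : wt (- (M + N + N)%N%:Z) u = u.
    by rewrite -[RHS](wt_iterF hU N wv); congr (wt _ _); lia.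
  have uc : c \is a GRing.unit by apply: lowest_coef_unit => //; lia.
  have := iterF_iterE_lowest ht hU wu eN N 0; rewrite -/c addn0 /= => eu.
  apply: (@Psplit c^-1 (iter N E u)); first by apply: (PEn _ _ _ wu); apply: (Plow _ _ wu).
  apply: IH.
    by rewrite linearB linearZ /= wv -{2}(wt_iterE hU N wu); congr (_ - _ *: wt _ _); lia.
  by rewrite -scaleNr addrC iterD iterZ eu scalerA mulNr mulVr // scaleN1r addNr.
(* Dually, with [w := E^N v] of highest weight [n]; moreover [F^N w] is a
   multiple of [E^(n-N) x], where [x := F^n w] has lowest weight. *)
have Ppos (M : nat) N v : wt M%:Z v = v -> iter N E v = 0 -> P v.
  elim: N v => [|N IH] v wv eN; first by rewrite [v]eN.
  pose n := (M + N + N)%N; pose w := iter N E v; pose x := iter n F w.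
  have ww : wt n w = w.
    by rewrite -[RHS](wt_iterE hU N wv); congr (wt _ _); lia.
  have htV := admissibleV pp ht; have hUV := Uqpi_swap pp ht hU.
  have wwV : wt (- (- n%:Z)) w = w by rewrite opprK.
  have wx : wt (- n%:Z) x = x.
    by rewrite -[RHS](wt_iterF hU n ww); congr (wt _ _); lia.
  (* By the exchange symmetry, [w] of weight [n] with [E w = 0] satisfies [F^(n+1) w = 0]. *)
  have Fx : F x = 0 := lowest_nil htV hUV wwV eN.
  pose c := lowest_coef t^-1 n N 0; pose c' := lowest_coef t^-1 n (n - N) N.
  have uc : c \is a GRing.unit by apply: lowest_coef_unit => //; lia.
  have uc' : c' \is a GRing.unit by apply: lowest_coef_unit => //; lia.
  have := iterF_iterE_lowest htV hUV wwV eN N 0; rewrite -/c addn0 /= => ew.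
  have := iterF_iterE_lowest htV hUV wwV eN (n - N) N.
  have Nn : (N <= n)%N by rewrite /n; lia.
  rewrite -/c' subnK // => ex.
  have Py : P (iter N F w).
    rewrite -[iter N F w]scale1r -(mulVr uc') -scalerA -ex; apply: PZ.
    by apply: (PEn _ _ _ wx); apply: (Plow _ _ wx).
  apply: (Psplit c^-1 _ _ Py); apply: IH.
    by rewrite linearB linearZ /= wv -{2}(wt_iterF hU N ww); congr (_ - _ *: wt _ _); lia.
  by rewrite -scaleNr addrC iterD iterZ ew scalerA mulNr mulVr // scaleN1r addNr.
have Pwt k v : wt k v = v -> P v.
  move=> wv; have [N [eE eF]] := Uqpi_nil hU wv.
  case: (intP k) wv => [|M|M] wv; [exact: Ppos wv eE | exact: Ppos wv eE |].
  exact: Pneg wv eF.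
move=> v; have [s ->] := Uqpi_local hU v.
elim: s => [|k s IH]; first by rewrite big_nil.
rewrite big_cons -[wt k v]scale1r; apply: Plin => //.
by apply: (Pwt k); rewrite (Uqpi_orth hU) eqxx.
Qed.
End Strings.

(** * The reflection and its inverse *)

Section ReflectionMaps.
Variables (R : comUnitRingType) (p : R).
Hypothesis pp : p * p = 1.
Variable V : lmodType R.
Implicit Types (t : R) (wt : int -> {linear V -> V}) (E F T : {linear V -> V}).

Definition is_reflection t wt E F T :=
  forall k v, wt (- k) v = v -> refl_val p t E F k v (T v).

Lemma linear_pack (f : V -> V) : linear f -> exists T, forall v, T v = f v.
Proof.
move=> lf.
by exists (HB.pack_for {linear V -> V} f (GRing.isLinear.Build R V V *:%R f lf)).
Qed.

(** The term of index [d] shifts the weight by [2 (k + d) - 2 d = 2 k]. *)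
Lemma refl_val_wt t wt E F k v s : Uqpi p t wt E F ->
  wt (- k) v = v -> refl_val p t E F k v s -> wt k s = s.
Proof.
move=> hU wv [N _ ->]; rewrite /reflsum linear_sum; apply: eq_bigr => d _.
rewrite linearZ /=; congr (_ *: _).
rewrite /dpow; case ka: (k + d%:Z) => [a|a]; last by rewrite linear0.
rewrite iterZ scalerA linearZ /=; congr (_ *: _).
by rewrite -[RHS](wt_iterE hU a (wt_iterF hU d wv)); congr (wt _ _); lia.
Qed.

(** The cutoff varies with the vector, so [T] is chosen from a linear relation shown to be total and
    single-valued. *)
Lemma exists_reflection t wt E F : Uqpi p t wt E F ->
  exists T, is_reflection t wt E F T.
Proof.
move=> hU.
have wtP k v : wt k (wt k v) = wt k v by rewrite (Uqpi_orth hU) eqxx.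
(* The graph of [T], described componentwise. *)
pose G v w := forall k, refl_val p t E F k (wt (- k) v) (wt k w).
have Glin a u v w w' : G u w -> G v w' -> G (a *: u + v) (a *: w + w').
  by move=> h h' k; rewrite !linearP; apply: refl_val_linear.
have Gwt k v s : wt (- k) v = v -> refl_val p t E F k v s -> G v s.
  move=> wv h l; have ws := refl_val_wt hU wv h.
  rewrite -wv -ws !(Uqpi_orth hU) eqr_opp.
  by case: eqP => [->|_]; rewrite ?wv ?ws //; apply: refl_val0.
have Guniq v w w' : G v w -> G v w' -> w = w'.
  move=> h h'; have [s e] := Uqpi_local hU (w - w').
  apply/eqP; rewrite -subr_eq0 e big1 // => k _.
  by rewrite linearB (refl_val_uniq (h k) (h' k)) subrr.
have Gex v : exists w, G v w.
  have [s ->] := Uqpi_local hU v.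
  elim: s => [|k s [w IH]].
    by rewrite big_nil; exists 0 => k; rewrite !linear0; apply: refl_val0.
  have [N [_ eF]] := Uqpi_nil hU (wtP k v).
  rewrite big_cons; exists (1 *: reflsum p t E F (- k) N (wt k v) + w).
  rewrite -[X in G (X + _)]scale1r; apply: Glin => //.
  by apply: (Gwt (- k)); [rewrite opprK | exists N].
have [f Gf] := boolp.choice Gex.
have lf : linear f.
  by move=> a u v; apply: Guniq (Gf _) _; apply: Glin.
have [T eT] := linear_pack lf; exists T => k v wv.
have [N [_ eF]] := Uqpi_nil hU wv.
have h : refl_val p t E F k v (reflsum p t E F k N v) by exists N.
by rewrite eT (Guniq _ _ _ (Gf v) (Gwt _ _ _ wv h)).
Qed.

(** Exchanging twice gives back the data only up to [t^-1^-1] and [- - k]; this form lets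
    [reflectionK] be applied to the exchanged module, giving [T T' = 1]. *)
Lemma is_reflection_swap t wt E F T :
  is_reflection t wt E F T ->
  is_reflection t^-1^-1 (fun k => wt (- - k)) E F T.
Proof. by move=> h k v; rewrite invrK opprK; apply: h. Qed.

Lemma reflection_E t wt E F T k v : admissible p t -> Uqpi p t wt E F ->
  is_reflection t wt E F T -> wt (- k) v = v -> T (E v) = - t ^ k *: F (T v).
Proof.
move=> ht hU hT wv.
have wE : wt (- (k - 2)) (E v) = E v.
  by rewrite -[RHS](wtE hU wv); congr (wt _ _); ring.
have /refl_val_stable[N h] := hT _ _ wv.
have /refl_val_stable[N' h'] := hT _ _ wE.
(* One cutoff serves both [v] and [E v]; [reflsum_E] uses its successor in both sums. *)
pose M := maxn N N'.
have [e _] := h M (leq_maxl _ _); have [_ ->] := h M.+1 (leqW (leq_maxl _ _)).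
have [e' _] := h' M (leq_maxr _ _); have [_ ->] := h' M.+1 (leqW (leq_maxr _ _)).
exact: (reflsum_E pp ht hU).
Qed.

(** Only the term [d = 0] survives, since [F u = 0]. *)
Lemma reflection_lowest t wt E F T (n : nat) u : is_reflection t wt E F T ->
  wt (- n%:Z) u = u -> F u = 0 -> T u = dpow p t E n u.
Proof.
move=> hT wu Fu; apply: refl_val_uniq (hT _ _ wu) _; exists 1%N => //.
rewrite /reflsum big_nat1 expr0 scale1r addr0 /dpow /=.
by rewrite /brfact [in X in _ = _ *: iter _ _ (X *: _)]big_geq // invr1 scale1r.
Qed.

Lemma reflectionK t wt E F T T' : admissible p t -> Uqpi p t wt E F ->
  is_reflection t wt E F T -> is_reflection t^-1 (fun k => wt (- k)) F E T' ->
  cancel T T'.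
Proof.
move=> ht hU hT hT'.
have htV := admissibleV pp ht; have hUV := Uqpi_swap pp ht hU.
have ut := adm_unit ht.
apply: (string_ind pp (P := fun v => T' (T v) = v) ht hU).
- by rewrite !linear0.
- by move=> a u v eu ev; rewrite !linearP eu ev.
- move=> k v; rewrite -{1}[k]opprK => wv ev.
  have wT := refl_val_wt hU wv (hT _ _ wv).
  rewrite (reflection_E ht hU hT wv) linearZ /=.
  (* [T v] has weight [- k], so the exchanged relation contributes [- (t^-1) ^ (- k)], the inverse
     of the factor [- t ^ (- k)] already present. *)
  rewrite (reflection_E htV hUV hT' (k := - k)) /= ?opprK //.
  by rewrite ev scalerA mulrNN -exprMzr ?unitrV // divrr // exp1rz scale1r.
- move=> n u wu Fu; rewrite (reflection_lowest hT wu Fu).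
  pose w := iter n E u.
  have ww : wt (- - n%:Z) w = w.
    by rewrite -[RHS](wt_iterE hU n wu); congr (wt _ _); lia.
  have Ew : E w = 0 := lowest_nil pp ht hU wu Fu.
  rewrite /dpow linearZ /= -/w (reflection_lowest hT' ww Ew).
  have := iterF_iterE_lowest pp ht hU wu Fu n 0; rewrite addn0 => e.
  rewrite /dpow e !scalerA /=.
  (* The brackets of [i + 1] form the conjugate factorial and those of [n - i], in reverse order,
     the plain one: exactly the denominators in [T'] and [T]. *)
  have -> : lowest_coef p t n n 0 = brfact p t^-1 n * brfact p t n.
    rewrite /lowest_coef big_split /= /brfact !big_add1 /=; congr (_ * _).
      by apply: eq_bigr => i _; congr (br _ _ _); lia.
    rewrite big_nat_rev /= !big_nat; apply: eq_bigr => i /andP[_ lt].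
    by congr (br _ _ _); lia.
  by rewrite -mulrA mulKr ?brfact_unit // mulVr ?brfact_unit // scale1r.
Qed.

End ReflectionMaps.

(** * The ground ring and its bar involution *)

Lemma fraction_reprE (A : idomainType) (x : {fraction A}) :
  tofrac \n_(repr x) = x * tofrac \d_(repr x).
Proof.
rewrite -{2}[x]reprK; unlock tofrac; rewrite -[RHS]FracField.pi_mul.
apply/eqmodP; rewrite /= FracField.equivfE /FracField.mulf.
by rewrite !numden_Ratio ?mulf_neq0 ?oner_neq0 ?denom_ratioP // !mulr1 mul1r mulrC.
Qed.

HB.instance Definition _ := GRing.RMorphism.copy ratQ (@tofrac _ \o (@polyC rat)).

Definition evalV (f : {poly rat}) : Qq := (map_poly ratQ f).[qq^-1].

Lemma evalVM f g : evalV (f * g) = evalV f * evalV g.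
Proof. by rewrite /evalV rmorphM hornerM. Qed.

Lemma evalVD f g : evalV (f + g) = evalV f + evalV g.
Proof. by rewrite /evalV rmorphD hornerD. Qed.

Lemma qq_neq0 : qq != 0.
Proof. by rewrite tofrac_eq0 polyX_eq0. Qed.

(* [qq ^+ n * evalV f] is the polynomial reversal of [f]. *)
Lemma evalV_eq0 f : evalV f = 0 -> f = 0.
Proof.
move=> e; pose n := size f; pose g := \poly_(i < n.+1) f`_(n - i).
have g0 : g = 0.
  apply/eqP; rewrite -tofrac_eq0; apply/eqP.
  transitivity (qq ^+ n * evalV f); last by rewrite e mulr0.
  rewrite /evalV (horner_coef_wide (n := n.+1)); last first.
    by rewrite (leq_trans (size_poly _ _)).
  rewrite /g poly_def rmorph_sum mulr_sumr (reindex_inj rev_ord_inj) /=.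
  apply: eq_bigr => i _.
  have le : (i <= n)%N by rewrite -ltnS.
  rewrite subSS coef_map (subKn le) -mul_polyC rmorphM rmorphXn mulrCA exprVn; congr (_ * _).
  have -> : qq ^+ n = qq ^+ (n - i) * qq ^+ i by rewrite -exprD subnK.
  by rewrite mulfK ?expf_neq0 ?qq_neq0.
apply/polyP => i; rewrite coef0.
have [le|lt] := leqP n i; first by rewrite nth_default.
have := congr1 (fun h : {poly rat} => h`_(n - i)) g0.
by rewrite coef0 coef_poly ltnS leq_subr subKn // ltnW.
Qed.

(** Independence of the chosen fraction: [evalV] is multiplicative, hence preserves
    cross-multiplication, and its injectivity keeps denominators nonzero. *)
Lemma barQE x n d : d != 0 -> x * tofrac d = tofrac n -> barQ x = evalV n / evalV d.
Proof.
move=> d0 e; rewrite /barQ -/(evalV _) -/(evalV _).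
set r := repr x.
have nz f : f != 0 -> evalV f != 0 by apply: contra_neq; apply: evalV_eq0.
have := fraction_reprE x; rewrite -/r => er.
have er2 : \n_r * d = n * \d_r.
  by apply/eqP; rewrite -tofrac_eq !rmorphM /= er -e mulrAC.
apply/eqP; rewrite eqr_div ?nz ?denom_ratioP //.
by rewrite -!evalVM er2.
Qed.

Lemma fractionP x : exists2 nd : {poly rat} * {poly rat}, nd.2 != 0 &
  x * tofrac nd.2 = tofrac nd.1 :> Qq.
Proof.
by exists (\n_(repr x), \d_(repr x)); rewrite ?denom_ratioP // fraction_reprE.
Qed.

Lemma barQ_tofrac f : barQ (tofrac f) = evalV f.
Proof.
rewrite (@barQE _ f 1) ?oner_neq0 ?rmorph1 ?mulr1 //.
by rewrite /evalV rmorph1 hornerC divr1.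
Qed.

Lemma barQD : {morph barQ : x y / x + y}.
Proof.
move=> x y; have [[n d] /= d0 e] := fractionP x; have [[n' d'] /= d0' e'] := fractionP y.
have nz f : f != 0 -> evalV f != 0 by apply: contra_neq; apply: evalV_eq0.
rewrite (barQE d0 e) (barQE d0' e') addf_div ?nz // -!evalVM -evalVD.
apply: barQE; first by rewrite mulf_neq0.
by rewrite rmorphD !rmorphM /= -e -e' mulrDl; congr (_ + _); ring.
Qed.

Lemma barQM : {morph barQ : x y / x * y}.
Proof.
move=> x y; have [[n d] /= d0 e] := fractionP x; have [[n' d'] /= d0' e'] := fractionP y.
rewrite (barQE d0 e) (barQE d0' e') mulf_div -!evalVM.
apply: barQE; first by rewrite mulf_neq0.
by rewrite !rmorphM /= -e -e'; ring.
Qed.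

Lemma barQ1 : barQ 1 = 1.
Proof. by have := barQ_tofrac 1; rewrite /evalV !rmorph1 hornerC. Qed.

Lemma barQ0 : barQ 0 = 0.
Proof. by have := barQ_tofrac 0; rewrite /evalV !rmorph0 horner0. Qed.

Lemma barQ_qq : barQ qq = qq^-1.
Proof. by rewrite barQ_tofrac /evalV map_polyX hornerX. Qed.

Lemma bar_is_zmod_morphism : zmod_morphism bar.
Proof.
have barQN x : barQ (- x) = - barQ x.
  by apply/eqP; rewrite -addr_eq0 -barQD addNr barQ0.
move=> [a b] [c d]; rewrite /bar /=; congr pair; by rewrite barQD barQN.
Qed.

Lemma bar_is_monoid_morphism : monoid_morphism bar.
Proof.
split; first by rewrite /bar /= barQ1 barQ0.
by move=> [a b] [c d]; rewrite /bar /= !barQD !barQM.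
Qed.

HB.instance Definition _ := GRing.isZmodMorphism.Build Qpi Qpi bar bar_is_zmod_morphism.
HB.instance Definition _ :=
  GRing.isMonoidMorphism.Build Qpi Qpi bar bar_is_monoid_morphism.

(** * Units of [Q(q)^pi] and admissibility of [q] *)

Lemma pi_pi : pi * pi = 1.
Proof. by rewrite Qpi_mulE Qpi_oneE /Qpi_mul /Qpi_one /= !mulr0 !mul0r mulr1 add0r addr0. Qed.

Lemma unit_scalar (a : Qq) : a != 0 -> ((a, 0) : Qpi) \is a GRing.unit.
Proof.
move=> a0; have : Qpi_norm (a, 0) != 0.
  by rewrite /Qpi_norm /= expr0n subr0 expf_neq0.
exact.
Qed.

Lemma q_unit : q \is a GRing.unit.
Proof. by apply: unit_scalar; exact: qq_neq0. Qed.

Lemma qX n : q ^+ n = (qq ^+ n, 0).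
Proof.
elim: n => [|n IH]; first by [].
by rewrite exprS IH Qpi_mulE /Qpi_mul /= -exprS !mulr0 !mul0r !addr0.
Qed.

Lemma bar_pi : bar pi = pi.
Proof. by rewrite /bar /= barQ0 barQ1. Qed.

Lemma bar_q : bar q = q^-1.
Proof.
apply: (mulrI q_unit); rewrite divrr ?q_unit // /bar /= barQ0 barQ_qq.
by congr pair; rewrite /= ?divff ?qq_neq0 // ?mulr0 ?mul0r ?addr0.
Qed.

(** [q] is not a root of unity, by comparing the degrees of [X^n] and 1; without a [pi] component,
    nonzero means invertible. *)
Lemma qX_sub1_unit n : (0 < n)%N -> q ^+ n - 1 \is a GRing.unit.
Proof.
move=> n0.
have -> : q ^+ n - 1 = (qq ^+ n - 1, 0).
  by rewrite qX; congr pair; exact: (subr0 (0 : Qq)).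
apply: unit_scalar; rewrite subr_eq0 -(rmorph1 (@tofrac {poly rat})) -rmorphXn tofrac_eq.
apply/eqP => /(congr1 (size \o polyseq)); rewrite /= size_polyXn size_poly1 => -[e].
by rewrite e in n0.
Qed.

(* Multiplying by the conjugate [(p t)^n + t^-n] gets rid of [p]. *)
Lemma br_num_unit (R : comUnitRingType) (p t : R) n : p * p = 1 ->
  t \is a GRing.unit -> t ^+ (4 * n) - 1 \is a GRing.unit ->
  (p * t) ^+ n - t^-1 ^+ n \is a GRing.unit.
Proof.
move=> pp ut u4; suff : ((p * t) ^+ n - t^-1 ^+ n) * ((p * t) ^+ n + t^-1 ^+ n)
    \is a GRing.unit by rewrite unitrM => /andP[].
have -> : ((p * t) ^+ n - t^-1 ^+ n) * ((p * t) ^+ n + t^-1 ^+ n) =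
    t^-1 ^+ (n + n) * (t ^+ (4 * n) - 1).
  have e : t^-1 * t = 1 by rewrite mulVr.
  rewrite mulrBr mulr1 (_ : (4 * n = (n + n) + (n + n))%N); last by lia.
  rewrite (exprD t) mulrA -exprMn e expr1n mul1r !exprD exprMn.
  have pn : p ^+ n * p ^+ n = 1 by rewrite -exprMn pp expr1n.
  set a := p ^+ n in pn *; set b := t ^+ n; set c := t^-1 ^+ n.
  transitivity (a * a * (b * b) - c * c); first by ring.
  by rewrite pn mul1r.
by rewrite unitrM u4 unitrX ?unitrV.
Qed.

Lemma admissible_of_pow (R : comUnitRingType) (p t : R) : p * p = 1 ->
  t \is a GRing.unit ->
  (forall n, (0 < n)%N -> t ^+ n - 1 \is a GRing.unit) -> admissible p t.
Proof.
move=> pp ut un.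
have num n : (0 < n)%N -> (p * t) ^+ n - t^-1 ^+ n \is a GRing.unit.
  by move=> n0; apply: br_num_unit => //; apply: un; rewrite muln_gt0.
(* The denominator of the brackets is the numerator at [n = 1]. *)
have uD : p * t - t^-1 \is a GRing.unit by have := num 1%N isT; rewrite !expr1.
split=> // n n0; rewrite /br unitrM unitrV uD andbT -exprz_inv.
exact: num.
Qed.

Lemma q_admissible : admissible pi q.
Proof. exact: admissible_of_pow pi_pi q_unit qX_sub1_unit. Qed.

(** Justifies modelling the bar involution, which fixes [pi] and inverts [q], by the substitution of
    [t^-1] for [t]. *)
Lemma rmorph_br (R : comUnitRingType) (p t : R) (f : {rmorphism R -> R}) n :
  p * p = 1 -> admissible p t -> f p = p -> f t = t^-1 ->
  f (br p t n) = br p t^-1 n.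
Proof.
move=> pp ht fp ft; have ut := adm_unit ht.
have upt : p * t \is a GRing.unit by rewrite unitrM ut (p_unit pp).
rewrite /br rmorph_div ?(adm_diff ht) // !rmorphB !rmorphXz //.
by rewrite rmorphM rmorphV // fp ft.
Qed.

Lemma bar_qint k : bar (qint k) = br pi q^-1 k.
Proof. exact: (rmorph_br k pi_pi q_admissible bar_pi bar_q). Qed.

Lemma bar_qfact d : bar (qfact d) = brfact pi q^-1 d.
Proof. by rewrite rmorph_prod /=; apply: eq_bigr => i _; apply: bar_qint. Qed.

(** * Comparison with the stated sums *)

Lemma dpow_bardivpow (V : lmodType Qpi) (X : {linear V -> V}) (a : nat) v :
  dpow pi q^-1 X a v = bardivpow X a v.
Proof. by rewrite /bardivpow bar_qfact. Qed.

(** Below [lowbd k] the exponent [k + d] is negative and [dpow] is zero; from there on [absz] leaves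
    [k + d] unchanged. *)
Lemma refl_val_finsum (V : lmodType Qpi) t (E F : {linear V -> V}) k v s :
  refl_val pi t E F k v s ->
  finsum_from (lowbd k)
    (fun d : nat => (- t) ^+ d *: dpow pi t E (absz (k + d%:Z)) (dpow pi t F d v)) s.
Proof.
move=> /refl_val_stable[N h]; exists (maxn N (lowbd k)).
have [eF ->] := h _ (leq_maxl N (lowbd k)); split.
  by move=> d le; rewrite (dpow_killed _ _ eF) ?dpow0 ?scaler0 // lez_nat.
rewrite /reflsum (big_cat_nat (n := lowbd k)) ?leq_maxr //=.
rewrite [X in X + _]big_nat [X in X + _]big1 ?add0r; last first.
  move=> d /andP[_]; rewrite /lowbd /dpow => lt.
  by case e: (k + d%:Z) => [a|a]; rewrite ?scaler0 //; lia.
rewrite !big_nat; apply: eq_bigr => d /andP[+ _]; rewrite /lowbd => le.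
by congr (_ *: dpow _ _ _ _ _); lia.
Qed.

Lemma is_Uqpi_moduleE (V : lmodType Qpi) (onek : int -> {linear V -> V})
    (E F : {linear V -> V}) :
  is_Uqpi_module onek E F -> integrable onek E F -> Uqpi pi q onek E F.
Proof.
move=> [orth loc hE hF comm] int; split=> //.
  by move=> k v; rewrite comm bar_qint.
by move=> k v /int[N h]; exists N; apply: h.
Qed.

Theorem mainTheorem4 (V : lmodType Qpi) (onek : int -> {linear V -> V})
    (E F : {linear V -> V}) :
  is_Uqpi_module onek E F -> integrable onek E F ->
  exists T Tinv : {linear V -> V},
    [/\ cancel T Tinv, cancel Tinv T,
        (forall (k : int) (w : V),
           in_weight onek k w <-> exists v, in_weight onek (- k) v /\ T v = w),
        (forall (k : int) (v : V), in_weight onek (- k) v ->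
           finsum_from (lowbd k)
             (fun d : nat => (- q) ^+ d *: divpow E (absz (k + d%:Z)) (divpow F d v))
             (T v)) &
        (forall (k : int) (v : V), in_weight onek k v ->
           finsum_from (lowbd k)
             (fun d : nat => (- q) ^- d *: bardivpow F (absz (k + d%:Z)) (bardivpow E d v))
             (Tinv v))].
Proof.
move=> hmod hint; have hU := is_Uqpi_moduleE hmod hint.
have hq := q_admissible; have hqV := admissibleV pi_pi hq.
have hUV := Uqpi_swap pi_pi hq hU.
have [T hT] := exists_reflection hU.
have [T' hT'] := exists_reflection hUV.
have TK : cancel T T' := reflectionK pi_pi hq hU hT hT'.
have T'K : cancel T' T := reflectionK pi_pi hqV hUV hT' (is_reflection_swap hT).
exists T, T'; split=> //.
- move=> k w; split=> [ww|[v [wv <-]]]; last exact: refl_val_wt hU wv (hT _ _ wv).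
  exists (T' w); split; last exact: T'K.
  have wwV : onek (- - k) w = w by rewrite opprK.
  exact: refl_val_wt hUV wwV (hT' _ _ wwV).
- by move=> k v wv; apply: refl_val_finsum; apply: hT.
- move=> k v wv; have wvV : onek (- - k) v = v by rewrite opprK.
  have [N [h0 hs]] := refl_val_finsum (hT' _ _ wvV).
  have e d : (- q) ^- d *: bardivpow F (absz (k + d%:Z)) (bardivpow E d v) =
     (- q^-1) ^+ d *: dpow pi q^-1 F (absz (k + d%:Z)) (dpow pi q^-1 E d v).
    by rewrite !dpow_bardivpow -invrN exprVn.
  exists N; split=> [d le|]; first by rewrite e h0.
  by rewrite hs; apply: eq_bigr => d _; rewrite e.
Qed.
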